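(* There is a function $\varepsilon:\mathbb{N}\to\mathbb{R}$ with $\varepsilon(d)\to 0$ as $d\to\infty$ such that for every integer $g\ge 3$ and every positive integer $d$ there exists a finite diameter graph $G$ in $\mathbb{R}^d$ with girth at least $g$ and $\chi(G)\ge (1.107+\varepsilon(d))^{\sqrt{d}}$.
   Context: A graph $G$ is a diameter graph in $\mathbb{R}^d$ if there is an injective map $\phi:V(G)\to\mathbb{R}^d$ such that for any two adjacent vertices $u,v$, the distance $\|\phi(u)-\phi(v)\|$ equals the maximum distance $\max_{x,y\in V(G)}\|\phi(x)-\phi(y)\|$ (not every pair at maximum distance need be an edge). The girth of a graph is the length of its shortest cycle. $\chi(G)$ denotes the chromatic number. *)

(* Defs.v *)
From HB Require Import structures.
From mathcomp Require Import all_boot all_order all_algebra.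
From mathcomp Require Import all_classical all_reals all_analysis.
From mathcomp Require Import Rstruct Rstruct_topology.
From Stdlib Require Import Rdefinitions.
Notation R := Rdefinitions.R.
Set Implicit Arguments. Unset Strict Implicit. Unset Printing Implicit Defensive.
Import Order.TTheory GRing.Theory Num.Theory.
Local Open Scope ring_scope.

Definition edist (d : nat) (x y : 'rV[R]_d) : R :=
  Num.sqrt (\sum_(i < d) (x ord0 i - y ord0 i) ^+ 2).

Definition simple_graph (V : finType) (e : rel V) : Prop :=
  symmetric e /\ irreflexive e.

(* maximum distance max_{x,y in V} |phi x - phi y| (0 if V is empty) *)
Definition max_dist (V : finType) (d : nat) (phi : V -> 'rV[R]_d) : R :=
  \big[Num.max/0]_(x : V) \big[Num.max/0]_(y : V) edist (phi x) (phi y).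

Definition diameter_graph (V : finType) (e : rel V) (d : nat) : Prop :=
  exists phi : V -> 'rV[R]_d, injective phi /\
    forall u v, e u v -> edist (phi u) (phi v) = max_dist phi.

(* girth(G) >= g : every cycle (a closed walk through k >= 3 distinct
   vertices) has length at least g; acyclic graphs have infinite girth. *)
Definition girth_at_least (V : finType) (e : rel V) (g : nat) : Prop :=
  forall s : seq V, leq 3 (size s) -> uniq s -> path.cycle e s -> leq g (size s).

Definition colorableb (V : finType) (e : rel V) (k : nat) : bool :=
  [exists c : {ffun V -> 'I_k}, [forall x, forall y, e x y ==> (c x != c y)]].

(* chromatic number: least k admitting a proper k-colouring
   (for loopless graphs such a k <= #|V| always exists). *)
Definition chromatic_number (V : finType) (e : rel V) : nat :=
  \big[minn/#|V|]_(k < #|V|.+1 | colorableb e k) k.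

(* Main.v *)
(** Let H be the orthogonality graph of the vectors of {-1,0,1}^n that start with
1 and have q = 2^k nonzero entries.  By the polynomial method modulo 2, a set of
vectors without orthogonal pair has at most a elements, where a is exponentially
smaller than the number M of vectors (n = 2q and n = 3q suffice to interpolate
between powers of 2).

Orthogonality survives blowing up: the map (x, i) -> (c_i x (x) x, s_i x), with
c_i and s_i chosen so that all images have the same norm, sends every vector x to
arbitrarily many points of dimension n(n+3)/2; images of orthogonal vectors are
orthogonal and all other inner products are nonnegative, so orthogonal pairs
realise the diameter.

It remains to extract from a large blow-up of H a graph of girth g in which every
set W of density 1/k' > a/M spans an edge.  Such a W spans a positive proportion
of the edges of the blow-up.  Hence edges can be added greedily, avoiding vertices
of large degree and pairs at distance at most g, each one meeting a fixed
proportion of the sets W not yet met; after linearly many steps all sets W, of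
which there are at most exponentially many, are met. *)
From Stdlib Require Import Rdefinitions.
Require Import Defs.
From HB Require Import structures.
From mathcomp Require Import all_boot all_order all_algebra.
From mathcomp Require Import all_classical all_reals all_analysis.
From mathcomp Require Import Rstruct Rstruct_topology.
From mathcomp Require Import zify ring lra.
From mathcomp Require Import fintype finset.
Set Implicit Arguments. Unset Strict Implicit. Unset Printing Implicit Defensive.
Import Order.TTheory GRing.Theory Num.Theory.

(** * Greedy edge selection under degree and girth constraints *)

Section Greedy.
Variable V : finType.
Implicit Types (e G : rel V) (x y z : V) (W : {set V}).

Definition nbrs e x : {set V} := [set y | e x y].

Fixpoint ball e i x : {set V} :=
  if i is i'.+1 then \bigcup_(z in ball e i' x) (z |: nbrs e z) else [set x].

Lemma card_bigcup_leq (I : finType) (A : {set I}) (F : I -> {set V}) b :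
  (forall i, i \in A -> #|F i| <= b) -> #|\bigcup_(i in A) F i| <= #|A| * b.
Proof.
move=> Fb; rewrite -sum_nat_const.
apply: (@leq_trans (\sum_(i in A) #|F i|)); last exact: leq_sum.
elim/big_rec2: _ => [|i m B _ IH]; first by rewrite cards0.
by rewrite (leq_trans (leq_card_setU _ _)) // leq_add2l.
Qed.

Lemma card_ball e D i x :
  (forall z, #|nbrs e z| <= D) -> #|ball e i x| <= D.+1 ^ i.
Proof.
move=> degD; elim: i => [|i IH] /=; first by rewrite cards1.
rewrite expnSr; apply: leq_trans (leq_mul IH (leqnn _)).
apply: card_bigcup_leq => z _; rewrite cardsU1 -[D.+1]add1n.
by rewrite leq_add // leq_b1.
Qed.

Lemma ball_sub e i j x : i <= j -> ball e i x \subset ball e j x.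
Proof.
move=> /subnKC <-; elim: (j - i) => [|l IH]; first by rewrite addn0.
rewrite addnS /=; apply: (subset_trans IH); apply/subsetP => z zB.
by apply/bigcupP; exists z => //; rewrite setU11.
Qed.

Lemma path_ball e x p : path e x p -> last x p \in ball e (size p) x.
Proof.
elim/last_ind: p => [|p z IH]; first by rewrite /= set11.
rewrite rcons_path last_rcons size_rcons => /andP[/IH pB ez] /=.
by apply/bigcupP; exists (last x p) => //; rewrite !inE ez orbT.
Qed.

Definition add_edge e x y : rel V :=
  [rel a b | [|| e a b, (a == x) && (b == y) | (a == y) && (b == x)]].

Lemma add_edgeC e x y : add_edge e y x =2 add_edge e x y.
Proof. by move=> a b; rewrite /add_edge /=; congr (_ || _); exact: orbC. Qed.

(** A repetition-free walk from [x] to [y] visits them only at its two ends, and these are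
    consecutive only when [p] is empty. *)
Lemma add_edge_path e x y p : uniq (x :: rcons p y) -> p != [::] ->
  path (add_edge e x y) x (rcons p y) -> path e x (rcons p y).
Proof.
move=> U p0 /(pathP x) H; apply/(pathP x) => i; rewrite size_rcons => ip.
have := H i; rewrite size_rcons ip => /(_ isT) /= /or3P[//| |] /andP[/eqP E1 /eqP E2].
  have Ei : i.+1 = (size p).+1.
    apply/eqP; rewrite -(@nth_uniq _ x (x :: rcons p y)) //=.
    - by rewrite E2 nth_rcons ltnn eqxx.
    - by rewrite size_rcons; lia.
    - by rewrite size_rcons; lia.
  have Ei0 : i = 0.
    apply/eqP; rewrite -(@nth_uniq _ x (x :: rcons p y)) //=.
      by rewrite E1.
    by rewrite size_rcons; lia.
  by case/negP: p0; rewrite -size_eq0 -eqSS -Ei Ei0.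
have : i.+1 = 0.
  apply/eqP; rewrite -(@nth_uniq _ x (x :: rcons p y)) //=.
    by rewrite E2.
  by rewrite size_rcons; lia.
by [].
Qed.

(** A new cycle shorter than [g] would contain a path of [e] from [x] to [y] of length below [g],
    placing [y] in the ball. *)
Lemma add_edge_girth e x y g : symmetric e -> x != y -> y \notin ball e g x ->
  girth_at_least e g -> girth_at_least (add_edge e x y) g.
Proof.
move=> se xy far ge s s3 us cs; rewrite leqNgt; apply/negP => sg.
have farP p z : path e x (rcons p z) -> (size p < g) -> z != y.
  move=> /path_ball; rewrite last_rcons size_rcons => zB pg.
  apply: contraNneq far => <-; exact: (subsetP (ball_sub e x pg)).
(* A cycle that misses [x] or [y] cannot use the new edge, so it is already a cycle of [e]. *)
have [/andP[xs ys]|] := boolP ((x \in s) && (y \in s)); last first.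
  move=> nxy; have : path.cycle e s.
    apply: (@sub_in_cycle _ (mem s) _ _ _ _ _ cs); last by apply/allP.
    move=> a b ain bin /or3P[//| |] /andP[/eqP ea /eqP eb];
    by move: nxy; rewrite -ea -eb ?ain ?bin.
  by move/(ge _ s3 us); lia.
have [i t Es] := rot_to xs.
have yt : y \in t.
  have : y \in rot i s by rewrite mem_rot.
  by rewrite Es inE eq_sym (negbTE xy).
have {}us : uniq (x :: t) by rewrite -Es rot_uniq.
have {}cs : path.cycle (add_edge e x y) (x :: t) by rewrite -Es rot_cycle.
have st : size s = (size t).+1 by rewrite -(size_rot i) Es.
case/splitPr: yt us cs st => p1 p2 us cs st.
move: cs; rewrite /= rcons_path cat_path /= => /andP[/andP[P1 /andP[Pa P2]] Pl].
move: st; rewrite size_cat /= => st.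
(* If [y] directly follows [x], the way back from [y] to [x] through [p2] avoids the new edge;
   otherwise the arc through [p1] does. *)
case: (eqVneq p1 [::]) => [p10|p1n].
  have : path e y (rcons p2 x).
    apply: add_edge_path.
    - move: us; rewrite p10 cat0s cons_uniq -rcons_cons rcons_uniq => /andP[-> ->] //.
    - by apply: contraTneq s3 => E; rewrite st p10 E.
    - rewrite (eq_path (add_edgeC e x y)) rcons_path P2 /=.
      by move: Pl; rewrite last_cat.
  rewrite -rev_path last_rcons belast_rcons rev_cons.
  rewrite (@eq_path _ (fun z => e^~ z) e); last by move=> a b; rewrite se.
  by move=> /farP; rewrite size_rev eqxx; move=> /(_ ltac:(lia)).
have : path e x (rcons p1 y).
  apply: add_edge_path p1n _.
    by move: us; rewrite -cat_rcons cons_uniq cat_uniq mem_cat negb_or /= => /and3P[/andP[-> _] -> _].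
  by rewrite rcons_path P1.
by move=> /farP; rewrite eqxx; move=> /(_ ltac:(lia)).
Qed.

Lemma card_nbrs_add_edge e x y z :
  #|nbrs (add_edge e x y) z| <= #|nbrs e z| + (z == x) + (z == y).
Proof.
have -> : nbrs (add_edge e x y) z =
    nbrs e z :|: (if z == x then [set y] else set0)
    :|: (if z == y then [set x] else set0).
  by apply/setP => b; rewrite !inE /add_edge /= orbA; do 2 case: (z == _); rewrite ?inE ?andbF.
apply: leq_trans (leq_card_setU _ _) _; apply: leq_add.
  apply: leq_trans (leq_card_setU _ _) _; rewrite leq_add2l.
  by case: (z == x); rewrite ?cards1 ?cards0.
by case: (z == y); rewrite ?cards1 ?cards0.
Qed.

Definition edgeless e W := [forall x in W, forall y in W, ~~ e x y].

Variables (G : rel V) (F : {set {set V}}) (g D Q T : nat).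

Definition addable e (p : V * V) :=
  [&& G p.1 p.2, #|nbrs e p.1| < D, #|nbrs e p.2| < D & p.2 \notin ball e g p.1].

Definition uncovered e : {set {set V}} := [set W in F | edgeless e W].

(** The step count [t] bounds the degree sum only from above, so the state persists through steps
    that add no edge. *)
Record sparse_state e t : Prop := SparseState {
  ss_sym : symmetric e;
  ss_irr : irreflexive e;
  ss_sub : subrel e G;
  ss_girth : girth_at_least e g;
  ss_deg : forall z, #|nbrs e z| <= D;
  ss_sum : \sum_z #|nbrs e z| <= 2 * t }.

Hypothesis Gsym : symmetric G.
Hypothesis V0 : 0 < #|V|.
Hypothesis robust : forall e W, sparse_state e T -> W \in F ->
  #|V| ^ 2 <= Q * #|[set p | addable e p & (p.1 \in W) && (p.2 \in W)]|.

(** Double counting: by [robust], some addable pair lies in at least a fraction [1 / Q] of the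
    uncovered sets, and turning it into an edge covers all of these. *)
Lemma greedy_edge e : sparse_state e T -> uncovered e != set0 ->
  exists2 p, addable e p & Q * #|uncovered (add_edge e p.1 p.2)| <= Q.-1 * #|uncovered e|.
Proof.
move=> He B0.
pose hit p := [set W in uncovered e | (p.1 \in W) && (p.2 \in W)].
have [p /andP[pa ph]|H] := pickP (fun p => addable e p && (#|uncovered e| <= Q * #|hit p|)).
  exists p => //.
  have sub : uncovered (add_edge e p.1 p.2) \subset uncovered e :\: hit p.
    apply/subsetP => W; rewrite !inE => /andP[WF /forall_inP Wn].
    have We : edgeless e W.
      apply/forall_inP => a aW; apply/forall_inP => b bW.
      by have /forall_inP /(_ b bW) := Wn a aW; rewrite /add_edge /= negb_or => /andP[].
    rewrite WF We /= andbT; apply/negP => /andP[p1W p2W].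
    by have /forall_inP /(_ _ p2W) := Wn _ p1W; rewrite /add_edge /= !eqxx orbT.
  have := subset_leq_card sub; rewrite cardsD (setIidPr _); last first.
    by apply/subsetP => W; rewrite inE => /andP[].
  move=> hc.
  have : Q * #|uncovered (add_edge e p.1 p.2)| <= Q * (#|uncovered e| - #|hit p|).
    by rewrite leq_mul2l hc orbT.
  rewrite mulnBr -subn1 mulnBl mul1n => /leq_trans; apply; lia.
exfalso.
have E : \sum_(p | addable e p) #|hit p| =
    \sum_(W in uncovered e) #|[set p | addable e p & (p.1 \in W) && (p.2 \in W)]|.
  rewrite (eq_bigr (fun p => \sum_(W in uncovered e) ((p.1 \in W) && (p.2 \in W) : nat))).
    rewrite exchange_big /=; apply: eq_bigr => W _.
    rewrite -big_mkcondr -sum1_card; apply: eq_bigl => p; by rewrite !inE.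
  move=> p _; rewrite -big_mkcondr -sum1_card; apply: eq_bigl => W; by rewrite !inE.
have L : #|uncovered e| * #|V| ^ 2 <= Q * \sum_(p | addable e p) #|hit p|.
  rewrite E big_distrr /= -sum_nat_const; apply: leq_sum => W.
  by rewrite inE => /andP[WF _]; exact: robust.
(* By [H], [Q * #|hit p|] is strictly below [#|uncovered e|]; this lost unit is what contradicts
   [L]. *)
have U : Q * \sum_(p | addable e p) #|hit p| <= #|V| ^ 2 * #|uncovered e|.-1.
  rewrite big_distrr /= (@leq_trans (\sum_(p : V * V | addable e p) #|uncovered e|.-1)) //.
    apply: leq_sum => p pa; have := H p; rewrite pa /=.
    by move=> /negbT; rewrite -ltnNge; lia.
  rewrite sum_nat_const leq_mul2r; apply/orP; right.
  by rewrite (leq_trans (max_card _)) // card_prod mulnn.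
move: B0; rewrite -card_gt0 => B0; have := leq_trans L U; rewrite mulnC leq_pmul2l ?expn_gt0 ?V0 //.
lia.
Qed.

Lemma add_edge_state e t p : sparse_state e t -> addable e p ->
  sparse_state (add_edge e p.1 p.2) t.+1.
Proof.
case: p => x y; move=> [se ie sub ge de su] /and4P[/= Gxy dx dy far].
have xy : x != y.
  apply: contraNneq far => ->; apply: (subsetP (ball_sub e y (leq0n g))).
  by rewrite /= set11.
split.
- move=> a b; rewrite /add_edge /= se; congr (_ || _).
  by rewrite orbC [(a == y) && _]andbC [(a == x) && _]andbC.
- move=> a; rewrite /add_edge /= ie /= andbC orbb; apply/negP => /andP[/eqP-> /eqP E].
  by rewrite E eqxx in xy.
- by move=> a b /or3P[/sub //| |] /andP[/eqP-> /eqP->] //; rewrite Gsym.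
- exact: add_edge_girth.
- move=> z; apply: leq_trans (card_nbrs_add_edge _ _ _ _) _.
  have := de z; case: (eqVneq z x) => [->|_]; case: (eqVneq _ y) => [E|_];
    rewrite ?addn0 ?addn1 //; by [rewrite E eqxx in xy | rewrite E].
- apply: (@leq_trans (\sum_z (#|nbrs e z| + (z == x) + (z == y)))).
    by apply: leq_sum => z _; exact: card_nbrs_add_edge.
  rewrite !big_split /= mulnS.
  have one w : \sum_z (z == w : nat) = 1.
    by rewrite (bigD1 w) //= eqxx big1 // => z /negbTE->.
  by rewrite !one -addnA addnC leq_add2l.
Qed.

Lemma sparse_state_widen e t t' : t <= t' -> sparse_state e t -> sparse_state e t'.
Proof. by move=> tt' [*]; split => //; lia. Qed.

(** Each step shrinks the number of uncovered sets by a factor [1 - 1 / Q], with denominators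
    cleared; once none is left, the graph is kept as it is. *)
Lemma greedy_steps t : t <= T -> exists2 e, sparse_state e t &
  #|uncovered e| * Q ^ t <= #|F| * Q.-1 ^ t.
Proof.
elim: t => [_|t IH tT].
  exists [rel _ _ | false].
    have nb0 z : #|nbrs [rel _ _ | false] z| = 0 by apply: eq_card0 => y; rewrite inE.
    split=> //= [|z|]; last by rewrite big1.
      by case=> [|a [|b s]] //= _ _; rewrite ?andbF.
    by rewrite nb0.
  by rewrite !expn0 !muln1 subset_leq_card //; apply/subsetP => W; rewrite inE => /andP[].
have [e He Be] := IH (ltnW tT).
have [U0|U0] := eqVneq (uncovered e) set0.
  exists e; first exact: sparse_state_widen He.
  by rewrite U0 cards0.
have [p pa pQ] := greedy_edge (sparse_state_widen (ltnW tT) He) U0.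
exists (add_edge e p.1 p.2); first exact: add_edge_state.
rewrite !expnS mulnA [_ * Q]mulnC.
apply: leq_trans (leq_mul pQ (leqnn _)) _.
by rewrite -mulnA [X in _ <= X]mulnCA leq_mul2l Be orbT.
Qed.

End Greedy.

(** This is [(1 - 1 / Q) ^ Q < 1 / 2]; [bern] keeps the first two terms of a binomial expansion. *)
Lemma double_expn_pred Q : 1 < Q -> 2 * Q.-1 ^ Q < Q ^ Q.
Proof.
case: Q => [|[|P]] //= _.
have bern k : P.+1 ^ k + k * P.+1 ^ k.-1 <= P.+2 ^ k.
  elim: k => [|k IH] //; rewrite expnS [P.+2 ^ _]expnS /=.
  apply: leq_trans (leq_mul (leqnn P.+2) IH).
  case: k {IH} => [|k]; first by rewrite !expn0; lia.
  by rewrite /= expnS; move: (P.+1 ^ k) => X; nia.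
apply: leq_trans (bern P.+2); rewrite /= !expnS.
have : 0 < P.+1 ^ P by rewrite expn_gt0.
by move: (P.+1 ^ P) => X; nia.
Qed.

(** Every [Q] steps more than halve the number of uncovered sets. As [F] has at most [2 ^ #|V|]
    members, less than one set survives [Q * #|V|] steps. *)
Lemma greedy_sparsification (V : finType) (G : rel V) (F : {set {set V}}) (g D Q : nat) :
  symmetric G -> 0 < #|V| -> 1 < Q ->
  (forall e W, sparse_state G g D e (Q * #|V|) -> W \in F ->
    #|V| ^ 2 <= Q * #|[set p | addable G g D e p & (p.1 \in W) && (p.2 \in W)]|) ->
  exists e : rel V, [/\ simple_graph e, subrel e G, girth_at_least e g &
    forall W, W \in F -> exists x y, [/\ x \in W, y \in W & e x y]].
Proof.
move=> Gsym V0 Q1 rob.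
have [e [se ie sub ge de su] Be] := greedy_steps Gsym V0 rob (leqnn _).
have U0 : uncovered F e = set0.
  apply/eqP; rewrite -cards_eq0 -leqn0 -ltnS.
  have : #|uncovered F e| * Q ^ (Q * #|V|) < 1 * Q ^ (Q * #|V|).
    apply: leq_ltn_trans Be _; rewrite mul1n !expnM.
    apply: (@leq_ltn_trans ((2 * Q.-1 ^ Q) ^ #|V|)); last first.
      by rewrite ltn_exp2r // double_expn_pred.
    rewrite expnMn leq_mul2r; apply/orP; right.
    by rewrite -cardsT -card_powerset subset_leq_card //; apply/subsetP => W _; rewrite inE subsetT.
  by rewrite ltn_mul2r => /andP[].
exists e; split => // W WF.
have : W \notin uncovered F e by rewrite U0 inE.
rewrite inE WF /= negb_forall_in => /exists_inP[x xW]; rewrite negb_forall_in.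
by move=> /exists_inP[y yW]; rewrite negbK => exy; exists x, y.
Qed.

(** By pigeonhole, a colouring with at most [k] colours has a class of at least [#|V| / k] vertices,
    which then spans an edge. The bound [k < #|V|] settles the default value of the minimum. *)
Lemma chromatic_number_gt (V : finType) (e : rel V) k : k < #|V| ->
  (forall W : {set V}, #|V| <= k * #|W| -> exists x y, [/\ x \in W, y \in W & e x y]) ->
  k < chromatic_number e.
Proof.
move=> kV He; rewrite /chromatic_number.
apply: (big_ind (fun j => k < j)) => // [x y kx ky|[j /= _] /existsP[c /forallP cP]].
  by rewrite leq_min kx.
rewrite ltnNge; apply/negP => jk.
have [i iP] : exists i : 'I_j, #|V| <= k * #|[set x | c x == i]|.
  apply/existsP; apply: contraT; rewrite negb_exists => /forallP Hn.
  have E : #|V| = \sum_(i < j) #|[set x | c x == i]|.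
    rewrite -sum1_card (partition_big c xpredT) //=; apply: eq_bigr => i _.
    by rewrite -sum1_card; apply: eq_bigl => x; rewrite inE.
  have j0 : 0 < j.
    have /card_gt0P[x0 _] : 0 < #|V| by exact: leq_ltn_trans kV.
    exact: leq_ltn_trans (ltn_ord (c x0)).
  have : k * #|V| <= j * #|V|.-1.
    have <- : \sum_(i < j) #|V|.-1 = j * #|V|.-1 by rewrite sum_nat_const card_ord.
    rewrite {1}E big_distrr /= leq_sum // => i _.
    by have := Hn i; rewrite -ltnNge => L; rewrite -ltnS prednK //; exact: leq_ltn_trans kV.
  have : j * #|V|.-1 <= k * #|V|.-1 by rewrite leq_mul2r jk orbT.
  have : 0 < #|V| by exact: leq_ltn_trans kV.
  nia.
have [x [y [xi yi exy]]] := He _ iP.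
move: xi yi; rewrite !inE => /eqP cx /eqP cy.
by have /forallP /(_ y) := cP x; rewrite exy cx cy eqxx.
Qed.

(** * Sparse subgraphs of a blow-up *)

Section BlowUp.
Variables (H : finType) (h : rel H) (a k g : nat).
Hypothesis h_sym : symmetric h.
Hypothesis h_edge : forall S : {set H}, a < #|S| ->
  exists u v, [/\ u \in S, v \in S & h u v].
Hypothesis ak : a * k < #|H|.
Hypothesis k0 : 0 < k.

(* With [N = #|V|], [Q * N] greedy steps leave at most [r / 2] vertices of degree
   [D], and a ball of radius [g] has at most [B = r / 4] vertices, so two fibres
   of size [r] still span at least [r ^ 2 / 8 = N ^ 2 / Q] addable pairs. *)
Let c := k * #|H| + 1.
Let Q := 8 * (#|H| * c) ^ 2.
Let D := 4 * Q * (#|H| * c).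
Let B := D.+1 ^ g.
Let r := 4 * B.
Let m := c * r.
Let V : finType := (H * 'I_m)%type.
Let G : rel V := [rel x y | h x.1 y.1].
Let fibre (W : {set V}) u := [set x in W | x.1 == u].

Let H0 : 0 < #|H|. Proof. exact: leq_ltn_trans ak. Qed.

Let Hc0 : 0 < #|H| * c. Proof. by rewrite muln_gt0 H0 /c addn1. Qed.

Let Q1 : 1 < Q.
Proof.
have : 0 < (#|H| * c) ^ 2 by rewrite expn_gt0 Hc0.
by rewrite /Q; move: (_ ^ 2) => z; lia.
Qed.

Let B0 : 0 < B. Proof. by rewrite expn_gt0. Qed.

Let cardV : #|V| = #|H| * c * r.
Proof. by rewrite card_prod card_ord mulnA. Qed.

(** If at most [a] fibres had [r] elements, [#|W|] would be at most [a * m + #|H| * r]. Since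
    [a * k < #|H|] and [c > k * #|H|], [k] times this is below [#|V|]. *)
Lemma dense_fibres (W : {set V}) : #|V| <= k * #|W| ->
  exists u v, [/\ r <= #|fibre W u|, r <= #|fibre W v| & h u v].
Proof.
move=> kW; pose S := [set u | r <= #|fibre W u|].
suff /h_edge[u [v [uS vS huv]]] : a < #|S|.
  by exists u, v; split => //; [move: uS | move: vS]; rewrite inE.
rewrite ltnNge; apply/negP => Sa.
have E : #|W| = \sum_u #|fibre W u|.
  rewrite -sum1_card (partition_big fst xpredT) //=; apply: eq_bigr => u _.
  by rewrite -sum1_card; apply: eq_bigl => x; rewrite inE.
have fib_m u : #|fibre W u| <= m.
  have <- : #|[set (u, i) | i : 'I_m]| = m by rewrite card_imset ?card_ord // => i j [].
  apply: subset_leq_card; apply/subsetP => -[u' i]; rewrite inE => /andP[_ /= /eqP->].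
  exact: imset_f.
have : #|W| <= #|S| * m + #|H| * r.
  have -> : #|S| * m = \sum_u (if u \in S then m else 0).
    by rewrite -sum_nat_const big_mkcond.
  have -> : #|H| * r = \sum_(u : H) r by rewrite sum_nat_const.
  rewrite E -big_split /=; apply: leq_sum => u _; rewrite inE.
  case: ifPn => [_|]; first exact: leq_trans (fib_m u) (leq_addr _ _).
  by rewrite -ltnNge add0n => /ltnW.
move: kW; rewrite cardV /m => kW W1.
have : #|H| * c * r <= k * (a * (c * r) + #|H| * r).
  apply: leq_trans kW _; rewrite leq_mul2l; apply/orP; right.
  by apply: leq_trans W1 _; rewrite leq_add2r leq_mul2r Sa orbT.
have -> : k * (a * (c * r) + #|H| * r) = (a * k * c + k * #|H|) * r by ring.
rewrite leq_pmul2r ?muln_gt0 // => L.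
have : (a * k).+1 * c <= #|H| * c by rewrite leq_mul2r ak orbT.
by rewrite mulSn {1}/c; lia.
Qed.

Lemma blow_up_robust e (W : {set V}) :
  sparse_state G g D e (Q * #|V|) -> #|V| <= k * #|W| ->
  #|V| ^ 2 <= Q * #|[set p | addable G g D e p & (p.1 \in W) && (p.2 \in W)]|.
Proof.
move=> [_ _ _ _ degD sumD] /dense_fibres[u [v [ru rv huv]]].
pose high := [set z | D <= #|nbrs e z|].
have high_r : 2 * #|high| <= r.
  have : #|high| * D <= 2 * (Q * #|V|).
    apply: leq_trans sumD; rewrite -sum_nat_const [X in _ <= X](bigID (mem high)) /=.
    apply: leq_trans (leq_addr _ _); apply: leq_sum => z; by rewrite inE.
  rewrite cardV /D.
  have -> : #|high| * (4 * Q * (#|H| * c)) = (2 * (Q * (#|H| * c))) * (2 * #|high|) by ring.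
  have -> : 2 * (Q * (#|H| * c * r)) = (2 * (Q * (#|H| * c))) * r by ring.
  by rewrite leq_pmul2l // muln_gt0 /= muln_gt0 Hc0 andbT ltnW.
pose low w := fibre W w :\: high.
have low_r w : r <= #|fibre W w| -> 2 * B <= #|low w|.
  move=> rw; rewrite cardsD.
  have : #|fibre W w :&: high| <= #|high| by apply: subset_leq_card; exact: subsetIr.
  by move: high_r rw; rewrite /r; lia.
have good_r x : B <= #|low v :\: ball e g x|.
  rewrite cardsD; have := low_r _ rv.
  have : #|low v :&: ball e g x| <= B.
    apply: leq_trans (card_ball g x degD).
    by apply: subset_leq_card; exact: subsetIr.
  lia.
have : 2 * B * B <= #|[set p | addable G g D e p & (p.1 \in W) && (p.2 \in W)]|.
  apply: (@leq_trans (\sum_(x in low u) \sum_(y in low v :\: ball e g x) 1)).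
    apply: leq_trans (leq_mul (low_r _ ru) (leqnn B)) _.
    by rewrite -sum_nat_const; apply: leq_sum => x _; rewrite sum1_card.
  rewrite pair_big_dep sum1_card; apply/subset_leq_card/subsetP => -[x y].
  rewrite [(x, y) \in _]inE /= inE 2!in_setD !inE /addable /G /=.
  rewrite -!ltnNge => /andP[/andP[dx /andP[xW /eqP xu]] /and3P[yB dy /andP[yW /eqP yv]]].
  by rewrite xW yW dx dy yB xu yv huv.
move=> /(leq_mul (leqnn Q)); apply: leq_trans.
rewrite cardV /r /Q; apply: eq_leq; ring.
Qed.

Theorem blow_up_sparsification : exists n (e : rel (H * 'I_n)),
  [/\ simple_graph e, (forall x y, e x y -> h x.1 y.1), girth_at_least e g &
      k < chromatic_number e].
Proof.
have V0 : 0 < #|V| by rewrite cardV !muln_gt0 H0 /= /c addn1.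
have rob e (W : {set V}) : sparse_state G g D e (Q * #|V|) ->
    W \in [set W : {set V} | #|V| <= k * #|W|] ->
    #|V| ^ 2 <= Q * #|[set p | addable G g D e p & (p.1 \in W) && (p.2 \in W)]|.
  by rewrite inE; exact: blow_up_robust.
have Gsym : symmetric G by move=> x y; exact: h_sym.
have [e [se sub ge cov]] := greedy_sparsification Gsym V0 Q1 rob.
exists m, e; split => //.
apply: chromatic_number_gt => [|W kW]; last by apply: cov; rewrite inE.
rewrite -[#|_|]/(#|V|) cardV /c.
have : 0 < #|H| * r by rewrite !muln_gt0 H0.
have : 0 < #|H| by []; have : 0 < r by rewrite muln_gt0.
nia.
Qed.

End BlowUp.

(** * Parity of binomial coefficients and the polynomial method modulo 2 *)

Lemma bin_pow2_even k s : 0 < s -> ~~ (2 ^ k %| s) -> ~~ odd 'C(s.-1, (2 ^ k).-1).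
Proof.
move=> s0; apply: contra => oC.
have q0 : 0 < 2 ^ k by rewrite expn_gt0.
(* With [q = 2 ^ k], [s * 'C(s - 1, q - 1) = q * 'C(s, q)]; an odd binomial is coprime to [q], so
   [q] would divide [s]. *)
have : 2 ^ k %| s * 'C(s.-1, (2 ^ k).-1).
  by rewrite mul_bin_diag prednK // dvdn_mulr.
by rewrite Gauss_dvdl // coprimeXl // coprime2n.
Qed.

(** The inner entries of row [2 ^ k] of Pascal's triangle are even, so neighbours in the previous
    row have equal parity, and that row starts with 1. *)
Lemma bin_pow2_odd k j : j < 2 ^ k -> odd 'C((2 ^ k).-1, j).
Proof.
have q0 : 0 < 2 ^ k by rewrite expn_gt0.
elim: j => [|j IH] jq; first by rewrite bin0.
have : ~~ odd 'C(2 ^ k, j.+1).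
  apply/negP => oC; have : 2 ^ k %| j.+1 * 'C(2 ^ k, j.+1).
    by rewrite -mul_bin_diag dvdn_mulr.
  rewrite Gauss_dvdl ?coprimeXl ?coprime2n // => /dvdn_leq => /(_ isT).
  by rewrite leqNgt jq.
rewrite -[X in 'C(X, _)](prednK q0) binS oddD (IH (ltnW jq)).
by case: (odd _).
Qed.

Section PolynomialMethod.
Local Open Scope ring_scope.

Lemma ffact_int n m : (n ^_ m)%:Z = \prod_(i < m) (n%:Z - i%:Z).
Proof.
elim: m => [|m IH]; first by rewrite big_ord0.
rewrite big_ord_recr /= -IH ffactnSr.
case: (leqP m n) => mn; first by rewrite PoszM subzn.
by rewrite ffact_small // mul0n mul0r.
Qed.

Section MonomialSpan.
Variables (F : fieldType) (T : finType) (n : nat) (v : T -> 'I_n -> F).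
Hypothesis v3 : forall x i, v x i ^+ 3 = v x i.
Local Notation expo := {ffun 'I_n -> 'I_3}.
Implicit Types (e : expo) (f : T -> F) (k : nat).

Definition mondeg e : nat := (\sum_i e i)%N.
Definition monval e x : F := \prod_i v x i ^+ e i.
Definition in_span k f :=
  exists c : expo -> F, forall x, f x = \sum_(e | (mondeg e <= k)%N) c e * monval e x.

(* The cube relation [v ^+ 3 = v] wraps exponent 3 back to exponent 1. *)
Definition bump3 (j : 'I_3) : 'I_3 := if j == 2%N :> nat then inord 1 else inord j.+1.
Definition raise i e : expo := [ffun j => if j == i then bump3 (e j) else e j].

Lemma bump3_leq j : (bump3 j <= j.+1)%N.
Proof.
rewrite /bump3; case: eqP => [->|/eqP j2]; first by rewrite inordK.
by rewrite inordK //; case: j j2 => [[|[|[|]]]].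
Qed.

Lemma bump3E x i j : v x i ^+ bump3 j = v x i * v x i ^+ j.
Proof.
rewrite /bump3 -exprS; case: eqP => [->|/eqP j2]; first by rewrite inordK // v3.
by rewrite inordK //; case: j j2 => [[|[|[|]]]].
Qed.

Lemma mondeg_raise i e : (mondeg (raise i e) <= (mondeg e).+1)%N.
Proof.
rewrite /mondeg (bigD1 i) //= [X in (_ <= X.+1)%N](bigD1 i) //= ffunE eqxx -addSn.
apply: leq_add (bump3_leq _) _; apply: eq_leq.
by apply: eq_bigr => j /negbTE ji; rewrite ffunE ji.
Qed.

Lemma monval_raise i e x : monval (raise i e) x = v x i * monval e x.
Proof.
rewrite /monval (bigD1 i) //= [X in _ = _ * X](bigD1 i) //= ffunE eqxx bump3E -mulrA.
by congr (_ * (_ * _)); apply: eq_bigr => j /negbTE ji; rewrite ffunE ji.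
Qed.

Lemma in_span_ext k f f' : f =1 f' -> in_span k f -> in_span k f'.
Proof. by move=> ff' [c cP]; exists c => x; rewrite -ff'. Qed.

Lemma in_span0 k : in_span k (fun=> 0).
Proof. by exists (fun=> 0) => x; rewrite big1 // => e _; rewrite mul0r. Qed.

Lemma in_spanD k f f' : in_span k f -> in_span k f' -> in_span k (fun x => f x + f' x).
Proof.
move=> [c cP] [c' cP']; exists (fun e => c e + c' e) => x.
by rewrite cP cP' -big_split /=; apply: eq_bigr => e _; rewrite mulrDl.
Qed.

Lemma in_spanZ k a f : in_span k f -> in_span k (fun x => a * f x).
Proof.
move=> [c cP]; exists (fun e => a * c e) => x.
by rewrite cP big_distrr /=; apply: eq_bigr => e _; rewrite mulrA.
Qed.

Lemma in_spanS k f : in_span k f -> in_span k.+1 f.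
Proof.
move=> [c cP]; exists (fun e => if (mondeg e <= k)%N then c e else 0) => x.
rewrite cP big_mkcond [RHS]big_mkcond /=; apply: eq_bigr => e _.
by case: leqP => [/leqW ->//|_]; rewrite mul0r if_same.
Qed.

Lemma in_spanM k f i : in_span k f -> in_span k.+1 (fun x => v x i * f x).
Proof.
move=> [c cP].
exists (fun e' => \sum_(e | (mondeg e <= k)%N && (raise i e == e')) c e) => x.
rewrite cP big_distrr /=.
rewrite (partition_big (raise i) (fun e' => mondeg e' <= k.+1)%N) /=; last first.
  by move=> e ek; apply: leq_trans (mondeg_raise i e) _.
apply: eq_bigr => e' _; rewrite big_distrl /=.
by apply: eq_bigr => e /andP[_ /eqP <-]; rewrite monval_raise mulrCA.
Qed.

Lemma in_span_affine k f (a : 'I_n -> F) b :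
  in_span k f -> in_span k.+1 (fun x => (\sum_i a i * v x i + b) * f x).
Proof.
move=> fk.
have S : in_span k.+1 (fun x => \sum_i a i * (v x i * f x)).
  elim: (index_enum _) => [|i s IH].
    by apply: in_span_ext (in_span0 _) => x; rewrite big_nil.
  apply: in_span_ext (in_spanD (in_spanZ (a i) (in_spanM i fk)) IH) => x.
  by rewrite big_cons.
apply: in_span_ext (in_spanD S (in_spanZ b (in_spanS fk))) => x.
by rewrite mulrDl big_distrl /=; congr (_ + _); apply: eq_bigr => i _; rewrite mulrA.
Qed.

Lemma in_span_prod k (a : 'I_n -> F) (b : nat -> F) :
  in_span k (fun x => \prod_(j < k) (\sum_i a i * v x i + b j)).
Proof.
elim: k => [|k IH].
  exists (fun e => (e == [ffun=> ord0])%:R) => x; rewrite big_ord0.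
  rewrite (bigD1 [ffun=> ord0]) /=; last first.
    by rewrite leqn0 /mondeg big1 // => i _; rewrite ffunE.
  rewrite eqxx mul1r big1 => [|e /andP[_ /negbTE->]]; last by rewrite mul0r.
  by rewrite addr0 /monval big1 // => i _; rewrite ffunE expr0.
apply: in_span_ext (in_span_affine a (b k) IH) => x.
by rewrite big_ord_recr /= mulrC.
Qed.

(** The matrix factors as coefficients times monomial values, with one inner index per admissible
    exponent vector. *)
Lemma rank_monomials N (x : 'I_N -> T) (f : 'I_N -> T -> F) k :
  (forall i, in_span k (f i)) ->
  (\rank (\matrix_(i, j) f i (x j)) <= #|[set e : expo | mondeg e <= k]|)%N.
Proof.
move=> /fin_all_exists[c cP]; set E := finset _.
have -> : \matrix_(i, j) f i (x j) =
    (\matrix_(i < N, l < #|E|) c i (enum_val l)) *m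
    (\matrix_(l < #|E|, j < N) monval (enum_val l) (x j)).
  apply/matrixP => i j; rewrite !mxE cP.
  rewrite (eq_bigr (fun l => c i (enum_val l) * monval (enum_val l) (x j))).
    rewrite -(big_enum_val (fun e => c i e * monval e (x j))) /=.
    by apply: eq_bigl => e; rewrite inE.
  by move=> l _; rewrite !mxE.
exact: leq_trans (mxrankM_maxl _ _) (rank_leq_col _).
Qed.

End MonomialSpan.

(* Weigh each exponent vector by [3 ^ - mondeg e]; the total weight is
   [(1 + 1/3 + 1/9) ^ n]. *)
Lemma card_expo n q : (0 < q)%N ->
  (#|[set e : {ffun 'I_n -> 'I_3} | mondeg e <= q.-1]| * 9 ^ n <= 3 ^ q.-1 * 13 ^ n)%N.
Proof.
move=> q0; set E := finset _.
(* Scaled by [9 ^ n], the weights become natural numbers, and each coordinate contributes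
   [9 + 3 + 1 = 13]. *)
have <- : (\sum_(e : {ffun 'I_n -> 'I_3}) \prod_i 3 ^ (2 - e i) = 13 ^ n)%N.
  rewrite -(bigA_distr_bigA (fun (i : 'I_n) (j : 'I_3) => 3 ^ (2 - j)))%N.
  by rewrite prod_nat_const card_ord !big_ord_recr big_ord0.
rewrite -sum_nat_const big_distrr /= [X in (_ <= X)%N](bigID (mem E)) /=.
apply: leq_trans (leq_addr _ _); apply: leq_sum => e; rewrite inE => eq'.
apply: (@leq_trans (3 ^ mondeg e * \prod_i 3 ^ (2 - e i))); last first.
  by rewrite leq_mul2r leq_exp2l // eq' orbT.
rewrite /mondeg expn_sum -big_split /= -[X in (9 ^ X <= _)%N](card_ord n) -prod_nat_const.
apply: eq_leq; apply: eq_bigr => i _; rewrite -expnD subnKC //.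
by rewrite -ltnS.
Qed.

Definition dotz n (x y : 'I_n -> int) : int := \sum_i x i * y i.

(* The matrix ['C(<v x, v y> + q - 1, q - 1)], with [q = 2 ^ k], is the identity
   modulo 2, hence invertible over the rationals, while its entries are
   polynomials of degree [q - 1] in [v y]. *)
Lemma independent_bound (T : finType) (n k : nat) (v : T -> 'I_n -> int) (I : {set T}) :
  (forall x i, v x i ^+ 3 = v x i) ->
  (forall x, dotz (v x) (v x) = (2 ^ k)%:Z) ->
  (forall x y, x != y -> - (2 ^ k)%:Z < dotz (v x) (v y) < (2 ^ k)%:Z) ->
  {in I &, forall x y, dotz (v x) (v y) != 0} ->
  (#|I| <= #|[set e : {ffun 'I_n -> 'I_3} | mondeg e <= (2 ^ k).-1]|)%N.
Proof.
move=> v3 vv vxy vI; set q := (2 ^ k)%N; have q0 : (0 < q)%N by rewrite expn_gt0.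
pose x (i : 'I_#|I|) : T := enum_val i.
pose t i j : int := dotz (v (x i)) (v (x j)).
(* The shift makes all entries positive: [s i j] is [2 * q] on the diagonal; elsewhere it lies
   strictly between 0 and [2 * q] and differs from [q], so it is no multiple of [q]. *)
pose s i j : nat := absz (t i j + q%:Z).
have sE i j : (s i j)%:Z = t i j + q%:Z.
  rewrite gez0_abs // /t; case: (eqVneq (x i) (x j)) => [->|/vxy /andP[+ _]].
    by rewrite vv.
  by rewrite -/q; lia.
have s0 i j : (0 < s i j)%N.
  have := sE i j; rewrite /t; case: (eqVneq (x i) (x j)) => [->|/vxy /andP[+ _]].
    by rewrite vv -/q; lia.
  by rewrite -/q; lia.
pose B : 'M[int]_#|I| := \matrix_(i, j) ('C((s i j).-1, q.-1))%:Z.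
have B2 : map_mx (intr : int -> 'F_2) B = 1%:M.
  apply/matrixP => i j; rewrite !mxE -[LHS]/(('C((s i j).-1, q.-1))%:R : 'F_2).
  have F2 m : (m%:R : 'F_2) = (odd m)%:R.
    by rewrite -Zp_nat_mod // modn2.
  rewrite F2; case: (eqVneq i j) => [->|ij].
    (* As [2 * q] is again a power of 2, the diagonal entry lies in a row of Pascal's triangle with
       only odd entries. *)
    have -> : s j j = (2 ^ k.+1)%N.
      by have := sE j j; rewrite /t vv -/q expnS -/q; lia.
    by rewrite bin_pow2_odd // expnS -/q; lia.
  have xij : x i != x j by rewrite (inj_eq enum_val_inj).
  rewrite (negbTE (bin_pow2_even _ _)) // -/q.
  have t0 := vI _ _ (enum_valP i) (enum_valP j); have := vxy _ _ xij.
  have := sE i j; rewrite /t -/q -/(x i) -/(x j) in t0 *.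
  move=> E /andP[t1 t2]; apply/negP => /dvdnP[c cE].
  move: E t0 t1 t2; rewrite cE; move: (dotz _ _) => w.
  by case: c {cE} => [|[|c]]; [lia|lia|nia].
have detB : \det B != 0.
  apply/eqP => d0; have := congr1 (fun M => \det M) B2.
  by rewrite /= det_map_mx d0 det1 rmorph0 => /eqP; rewrite eq_sym oner_eq0.
pose vq y i : rat := (v y i)%:~R.
have vq3 y i : vq y i ^+ 3 = vq y i by rewrite /vq -rmorphXn /= v3.
(* At [x j] this product is the falling factorial of [(s i j).-1] with [q - 1] factors, that is
   [(q - 1)!] times [B i j]; the scalar is invertible in [rat]. *)
pose f i y := \prod_(j < q.-1) (\sum_l vq (x i) l * vq y l + (q%:Z - 1 - j%:Z)%:~R).
have := rank_monomials x (fun i => in_span_prod vq3 q.-1 (vq (x i)) (fun j => (q%:Z - 1 - j%:Z)%:~R)).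
have -> : \matrix_(i, j) f i (x j) = (q.-1`!)%:R *: map_mx (intr : int -> rat) B.
  apply/matrixP => i j; rewrite !mxE /f.
  rewrite (eq_bigr (fun l : 'I_q.-1 => (((s i j).-1)%:Z - l%:Z)%:~R)); last first.
    move=> l _; have -> : \sum_l0 vq (x i) l0 * vq (x j) l0 = (t i j)%:~R.
      by rewrite /t /dotz rmorph_sum; apply: eq_bigr => l' _; rewrite rmorphM.
    rewrite -rmorphD; congr (_%:~R); have := sE i j; have := s0 i j; lia.
  rewrite -rmorph_prod /= -ffact_int -bin_ffact PoszM rmorphM /= mulrC.
  by rewrite -pmulrn.
rewrite mxrank_scale_nz ?pnatr_eq0 -?lt0n ?fact_gt0 //.
rewrite mxrank_unit // unitmxE det_map_mx unitfE intr_eq0 //.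
Qed.

End PolynomialMethod.

(** * Vectors over -1, 0, 1 with leading entry 1, and their number *)

Section SignedSets.
Local Open Scope ring_scope.
Variables m q : nat.
Hypothesis q0 : (0 < q)%N.

(* The pair [(A, B)] encodes the vector with leading entry 1, entries -1 on B,
   1 on A \ B and 0 off A.  The leading 1 rules out antipodal pairs. *)
Definition signed_set : predArgType :=
  {p : {set 'I_m} * {set 'I_m} | (#|p.1| == q.-1) && (p.2 \subset p.1)}.
HB.instance Definition _ := Finite.on signed_set.
Implicit Types x y : signed_set.

Definition svec x (i : 'I_m.+1) : int :=
  if unlift ord0 i is Some j then
    (if j \in (val x).1 then (-1) ^+ (j \in (val x).2) else 0)
  else 1.

Lemma svec0 x : svec x ord0 = 1.
Proof. by rewrite /svec unlift_none. Qed.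

Lemma svec_lift x j :
  svec x (lift ord0 j) = if j \in (val x).1 then (-1) ^+ (j \in (val x).2) else 0.
Proof. by rewrite /svec liftK. Qed.

Lemma svec3 x i : svec x i ^+ 3 = svec x i.
Proof.
rewrite /svec; case: (unlift _ _) => [j|]; last by rewrite expr1n.
by case: (j \in (val x).1) => //; case: (j \in (val x).2).
Qed.

Lemma svec_norm x : dotz (svec x) (svec x) = q%:Z.
Proof.
rewrite /dotz big_ord_recl svec0 mulr1.
rewrite (eq_bigr (fun j => if j \in (val x).1 then 1 else 0)); last first.
  move=> j _; rewrite svec_lift; case: (j \in (val x).1) => //.
  by case: (j \in (val x).2).
rewrite -big_mkcond /= sumr_const -[LHS]/(1 + #|(val x).1|%:R).
have /andP[/eqP-> _] := valP x.
by rewrite nat1r prednK // natz.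
Qed.

Lemma svec_inj x y : svec x =1 svec y -> x = y.
Proof.
move=> E; apply: val_inj.
have /andP[_ /subsetP sx] := valP x; have /andP[_ /subsetP sy] := valP y.
have E1 j := E (lift ord0 j).
have A j : ((j \in (val x).1) = (j \in (val y).1)) /\ ((j \in (val x).2) = (j \in (val y).2)).
  have := E1 j; rewrite !svec_lift; have := sx j; have := sy j.
  case: (j \in (val x).1); case: (j \in (val y).1);
    case: (j \in (val x).2); case: (j \in (val y).2) => // Hy Hx _;
    by [have := Hy isT | have := Hx isT].
case: (val x) (val y) A => [A1 B1] [A2 B2] /= A.
by congr (_, _); apply/setP => j; have [] := A j.
Qed.

(** The squared norms of [x + y] and [x - y] are [2 * q] plus or minus twice the inner product. The
    first is at least 4 because of the leading entries; the second vanishes only for [x = y]. *)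
Lemma svec_dot_bound x y : x != y -> - q%:Z < dotz (svec x) (svec y) < q%:Z.
Proof.
move=> xy.
have sq s : s ^+ 2 = 1 -> \sum_i (svec x i + s * svec y i) ^+ 2 =
    q%:Z + q%:Z + 2 * s * dotz (svec x) (svec y).
  move=> s2; rewrite -{1}(svec_norm x) -(svec_norm y) /dotz big_distrr -!big_split /=.
  by apply: eq_bigr => i _; rewrite sqrrD exprMn s2; ring.
apply/andP; split.
  have := sq 1 (expr1n _ _); rewrite big_ord_recl !svec0 !mul1r.
  have : 0 <= \sum_(i < m) (svec x (lift ord0 i) + 1 * svec y (lift ord0 i)) ^+ 2.
    by apply: sumr_ge0 => i _; rewrite sqr_ge0.
  move: (\sum_(i < m) _) (dotz _ _) => S t; lia.
rewrite ltNge; apply/negP => qt.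
have E := sq (-1) erefl.
have S0 : \sum_i (svec x i + -1 * svec y i) ^+ 2 = 0.
  apply/eqP; rewrite eq_le sumr_ge0 ?andbT => [|i _]; last by rewrite sqr_ge0.
  by rewrite E; move: (dotz _ _) qt => t; lia.
case/eqP: xy; apply: svec_inj => i; apply/eqP; rewrite -subr_eq0 -mulN1r.
rewrite -(sqrf_eq0 (_ + _)); apply/eqP.
by apply: (psumr_eq0P _ S0) => // j _; rewrite sqr_ge0.
Qed.

Lemma card_signed_set : #|{: signed_set}| = ('C(m, q.-1) * 2 ^ q.-1)%N.
Proof.
rewrite card_sig -sum1_card.
rewrite -(pair_big_dep (fun A : {set 'I_m} => #|A| == q.-1)
  (fun A B : {set 'I_m} => B \subset A) (fun _ _ => 1%N)) /=.
rewrite (eq_bigr (fun=> 2 ^ q.-1)%N); last first.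
  move=> A /eqP <-; rewrite -card_powerset sum1_card; apply: eq_card => B.
  by rewrite inE.
rewrite sum_nat_const; congr (_ * _)%N.
by rewrite -[in RHS](card_ord m) -card_draws; apply: eq_card => A; rewrite inE.
Qed.

End SignedSets.

Definition orthogonal_sets m q : rel (signed_set m q) :=
  [rel x y | dotz (svec x) (svec y) == 0%R].

Lemma orthogonal_sets_sym m q : symmetric (@orthogonal_sets m q).
Proof.
move=> x y; rewrite /orthogonal_sets /= /dotz; congr (_ == _).
by apply: eq_bigr => i _; rewrite mulrC.
Qed.

Lemma orthogonal_sets_edge m k (S : {set signed_set m (2 ^ k)}) :
  #|[set e : {ffun 'I_m.+1 -> 'I_3} | mondeg e <= (2 ^ k).-1]| < #|S| ->
  exists u v, [/\ u \in S, v \in S & orthogonal_sets u v].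
Proof.
have q0 : 0 < 2 ^ k by rewrite expn_gt0.
have [[u v] /and3P[uS vS uv] _|nE] :=
    pickP (fun p => [&& p.1 \in S, p.2 \in S & orthogonal_sets p.1 p.2]).
  by exists u, v.
rewrite ltnNge => /negP[]; apply: independent_bound.
- exact: svec3.
- by move=> x; exact: svec_norm.
- by move=> x y; exact: svec_dot_bound.
- by move=> x y xS yS; have := nE (x, y); rewrite /= xS yS => /negbT.
Qed.

(** Among the [r * q + 1] terms of the expansion of [(1 + (r - 1)) ^ (r * q)], the one of index [q]
    is largest, as the ratios of consecutive terms show; hence it is at least the average. *)
Lemma bin_mode r q : 0 < r ->
  r ^ (r * q) <= (r * q).+1 * ('C(r * q, q) * r.-1 ^ (r * q - q)).
Proof.
move=> r0; set n := r * q; pose T i := 'C(n, i) * r.-1 ^ (n - i).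
have qn : q <= n by rewrite /n leq_pmull.
have step i : i < n -> i.+1 * T i.+1 * r.-1 = (n - i) * T i.
  move=> i_n; rewrite /T mulnA mul_bin_left -!mulnA; congr (_ * (_ * _)).
  by rewrite -expnSr -subSn // subSS.
have up i : i < q -> T i <= T i.+1.
  move=> iq; have := step i (leq_trans iq qn).
  have : i.+1 * r.-1 <= n - i.
    have : i.+1 * r <= n by rewrite /n mulnC leq_mul2l iq orbT.
    by case: r r0 @n @T qn step => // r _ /= *; lia.
  have [->|r1] := posnP r.-1.
    rewrite !muln0 => _ /esym /eqP; rewrite muln_eq0 subn_eq0 leqNgt (leq_trans iq qn) /=.
    by move=> /eqP ->.
  move=> L E; rewrite -(@leq_pmul2l (i.+1 * r.-1)) ?muln_gt0 //.
  rewrite [X in _ <= X]mulnAC E; exact: leq_mul.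
have down i : q <= i -> i < n -> T i.+1 <= T i.
  move=> qi i_n; have := step i i_n.
  have : n - i <= i.+1 * r.-1.
    have : n <= i * r by rewrite /n mulnC leq_mul2r qi orbT.
    by case: r r0 @n @T qn step up i_n => // r _ /= *; lia.
  move=> L E; case: (posnP r.-1) => [r1|r1].
    by move: L; rewrite r1 muln0 leqn0 subn_eq0 leqNgt i_n.
  rewrite -(@leq_pmul2l (i.+1 * r.-1)) ?muln_gt0 //.
  rewrite [X in X <= _]mulnAC E; exact: leq_mul.
have top i : i <= n -> T i <= T q.
  move=> i_n; case: (leqP i q) => iq.
    rewrite -(subKn iq); move: (q - i) (leq_subr i q) => j.
    elim: j => [|j IH] jq; first by rewrite subn0.
    apply: leq_trans (IH (ltnW jq)); rewrite -(subnSK jq); apply: up.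
    by rewrite (leq_trans _ (leq_subr j q)) // -(subnSK jq).
  elim: i iq i_n => // i IH; rewrite ltnS leq_eqVlt => /orP[/eqP <- |qi] i_n.
    exact: down.
  exact: leq_trans (down _ (ltnW qi) i_n) (IH qi (ltnW i_n)).
rewrite -{1}(prednK r0) -addn1 expnDn.
apply: (@leq_trans (\sum_(i < n.+1) T q)).
  by apply: leq_sum => i _; rewrite exp1n muln1; apply: top; rewrite -ltnS.
by rewrite sum_nat_const card_ord.
Qed.

(** Forcing a nonzero leading entry costs a factor [r] in the choice of support, and fixing its sign
    a factor 2. *)
Lemma card_signed_set_geq r q : 0 < r -> 0 < q ->
  r ^ (r * q) * 2 ^ q <=
  2 * r * (r * q).+1 * r.-1 ^ (r * q - q) * #|{: signed_set (r * q).-1 q}|.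
Proof.
move=> r0 q0; rewrite card_signed_set //.
have E : r * 'C((r * q).-1, q.-1) = 'C(r * q, q).
  apply/eqP; rewrite -(eqn_pmul2l q0) -[X in 'C(r * q, X)](prednK q0).
  by rewrite -[X in _ == X * _](prednK q0) -mul_bin_diag mulnA [q * r]mulnC.
apply: leq_trans (leq_mul (bin_mode q r0) (leqnn _)) _.
rewrite -E -[in 2 ^ q](prednK q0) expnS.
by apply: eq_leq; ring.
Qed.

(** * Symmetric tensor squares and diameter embeddings *)

Section Embedding.
Local Open Scope ring_scope.

Lemma sum_symmetric (M : nmodType) n (f : 'I_n -> 'I_n -> M) :
  (forall i j, f i j = f j i) ->
  \sum_i \sum_j f i j =
  \sum_(i < n) \sum_(j < n | (i <= j)%N) f i j + \sum_(i < n) \sum_(j < n | (i < j)%N) f i j.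
Proof.
move=> fC; rewrite [X in _ = _ + X](exchange_big_dep xpredT) //= -big_split /=.
apply: eq_bigr => i _; rewrite (bigID (fun j : 'I_n => (i <= j)%N)) /=; congr (_ + _).
by apply: eq_big => [j|j _]; rewrite ?ltnNge.
Qed.

Lemma sum_upper_diag (M : nmodType) n (f : 'I_n -> 'I_n -> M) :
  \sum_(i < n) \sum_(j < n | (i <= j)%N) f i j =
  \sum_i f i i + \sum_(i < n) \sum_(j < n | (i < j)%N) f i j.
Proof.
rewrite -big_split /=; apply: eq_bigr => i _; rewrite (bigD1 i) //=; congr (_ + _).
by apply: eq_bigl => j; rewrite ltn_neqAle andbC eq_sym.
Qed.

(** Row 0 indexes the [N] linear coordinates; row [i + 1] holds the pairs [i <= j] of the symmetric
    square. *)
Definition veronese_index N := [set p : 'I_N.+1 * 'I_N | (p.1 <= p.2.+1)%N].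

Lemma sum_veronese_index (M : nmodType) N (f : 'I_N.+1 -> 'I_N -> M) :
  \sum_(p in veronese_index N) f p.1 p.2 =
  \sum_j f ord0 j + \sum_(i < N) \sum_(j < N | (i <= j)%N) f (lift ord0 i) j.
Proof.
rewrite (eq_bigl (fun p : 'I_N.+1 * 'I_N => xpredT p.1 && (p.1 <= p.2.+1)%N)); last first.
  by move=> p; rewrite inE.
rewrite -(pair_big_dep xpredT (fun (i : 'I_N.+1) (j : 'I_N) => i <= j.+1)%N f).
by rewrite big_ord_recl.
Qed.

Lemma card_veronese_index N : (2 * #|veronese_index N| = N * (N + 3))%N.
Proof.
rewrite -sum1_card (sum_veronese_index (fun _ _ => 1%N)).
have := sum_symmetric (fun _ _ : 'I_N => erefl 1%N).
have := sum_upper_diag (fun _ _ : 'I_N => 1%N).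
rewrite !sum_nat_const !card_ord !muln1.
set a := bigop _ _ _; set b := bigop _ _ _.
by rewrite -[(_ + _)%R]/(_ + _)%N; nia.
Qed.

(** The coordinates indexed by [A] are enumerated and padded with zeros up to dimension [d]. *)
Lemma embed_coordinates (K : pzRingType) (V J : finType) (A : {set J}) (F : V -> J -> K) d :
  (#|A| <= d)%N -> exists phi : V -> 'rV[K]_d, forall u v,
    \sum_(i < d) (phi u ord0 i - phi v ord0 i) ^+ 2 = \sum_(j in A) (F u j - F v j) ^+ 2.
Proof.
move=> Ad.
pose f u (i : nat) : K := oapp (fun j : 'I_#|A| => F u (enum_val j)) 0 (insub i).
exists (fun u => \row_(i < d) f u i) => u v.
rewrite (big_enum_val (fun j => (F u j - F v j) ^+ 2)).
rewrite (eq_bigr (fun i : 'I_d => (f u i - f v i) ^+ 2)); last by move=> i _; rewrite !mxE.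
rewrite [RHS](eq_bigr (fun i : 'I_#|A| => (f u i - f v i) ^+ 2)); last first.
  by move=> i _; rewrite /f valK.
rewrite (big_ord_widen _ (fun i => (f u i - f v i) ^+ 2) Ad) [RHS]big_mkcond /=.
apply: eq_bigr => i _; case: ifPn => // iA.
by rewrite /f insubN // subrr expr0n.
Qed.

End Embedding.

Section TwistedVeronese.
Local Open Scope ring_scope.
Variables (K : rcfType) (H : finType) (n q m : nat) (v : H -> 'I_n.+1 -> int).
Hypothesis q0 : (0 < q)%N.
Hypothesis v_head : forall x, v x ord0 = 1.
Hypothesis v_inj : forall x y, v x =1 v y -> x = y.
Hypothesis v_norm : forall x, dotz (v x) (v x) = q%:Z.
Local Notation V := (H * 'I_m)%type.
Implicit Types (u w : V) (x y : H).

(** The values [s i] are distinct, and [c] is chosen so that [c ^ 2 * q ^ 2 + s ^ 2 * q = q ^ 2],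
    the common squared norm. Being at most 1/2, [s i] does not exceed [c i]. *)
Let s (i : 'I_m) : K := i.+2%:R^-1.
Let c (i : 'I_m) : K := Num.sqrt (1 - s i ^+ 2 / q%:R).
Let vr x i : K := (v x i)%:~R.

(* The tensor square alone would make the copies [(x, i)] of [x] coincide; the
   small component [s i * x] separates them and vanishes in the inner product
   of orthogonal vectors. *)
Definition twisted_veronese u (p : 'I_n.+2 * 'I_n.+1) : K :=
  if unlift ord0 p.1 is Some i then
    c u.2 * ((if i == p.2 then 1 else Num.sqrt 2) * (vr u.1 i * vr u.1 p.2))
  else s u.2 * vr u.1 p.2.

Lemma s_bounds i : 0 < s i <= 2^-1.
Proof.
rewrite /s invr_gt0 ltr0n /= lef_pV2 ?posrE ?ltr0n // ler_nat //.
Qed.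

Lemma c_sqr i : c i ^+ 2 = 1 - s i ^+ 2 / q%:R.
Proof.
rewrite sqr_sqrtr //; have /andP[s0 s1] := s_bounds i.
have q1 : (1 : K) <= q%:R by rewrite ler1n.
rewrite subr_ge0 ler_pdivrMr ?ltr0n // mul1r; apply: le_trans q1; rewrite exprn_ile1 ?(ltW s0) //; lra.
Qed.

Lemma s_le_c i : s i <= c i.
Proof.
have /andP[s0 s1] := s_bounds i.
rewrite -(@ler_pXn2r _ 2) ?nnegrE ?sqrtr_ge0 ?(ltW s0) // c_sqr.
have q1 : (1 : K) <= q%:R by rewrite ler1n.
have : s i ^+ 2 / q%:R <= s i ^+ 2
  by rewrite ler_pdivrMr ?ltr0n // ler_peMr // exprn_ge0 // ltW.
have : s i ^+ 2 <= 2^-1 ^+ 2 by rewrite ler_pXn2r ?nnegrE ?(ltW s0) //; lra.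
by move: (s i ^+ 2) => z; lra.
Qed.

Lemma twisted_veronese0 u j : twisted_veronese u (ord0, j) = s u.2 * vr u.1 j.
Proof. by rewrite /twisted_veronese unlift_none. Qed.

Lemma twisted_veronese_lift u i j : twisted_veronese u (lift ord0 i, j) =
  c u.2 * ((if i == j then 1 else Num.sqrt 2) * (vr u.1 i * vr u.1 j)).
Proof. by rewrite /twisted_veronese liftK. Qed.

(** The factor [Num.sqrt 2] off the diagonal compensates for listing each unordered pair once, so
    the half sum is the full square of the inner product. *)
Lemma twisted_veronese_dot u w :
  \sum_(p in veronese_index n.+1) twisted_veronese u p * twisted_veronese w p =
  c u.2 * c w.2 * (dotz (v u.1) (v w.1))%:~R ^+ 2 +
  s u.2 * s w.2 * (dotz (v u.1) (v w.1))%:~R.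
Proof.
pose a i := vr u.1 i * vr w.1 i.
have -> : (dotz (v u.1) (v w.1))%:~R = \sum_i a i.
  by rewrite /dotz rmorph_sum; apply: eq_bigr => i _; rewrite rmorphM.
pose f i j := twisted_veronese u (i, j) * twisted_veronese w (i, j).
rewrite (eq_bigr (fun p => f p.1 p.2)); last by case.
rewrite sum_veronese_index /f addrC; congr (_ + _); last first.
  rewrite mulr_sumr; apply: eq_bigr => j _.
  by rewrite !twisted_veronese0 /a mulrACA.
rewrite expr2 mulr_suml /=.
rewrite [in RHS](eq_bigr (fun i => \sum_j a i * a j)); last by move=> i _; rewrite mulr_sumr.
rewrite (sum_symmetric (fun i j => mulrC (a i) (a j))) [X in _ = _ * (X + _)]sum_upper_diag.
rewrite sum_upper_diag -addrA mulrDr; congr (_ + _).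
  rewrite mulr_sumr; apply: eq_bigr => i _.
  by rewrite !twisted_veronese_lift eqxx /a; ring.
rewrite -big_split mulr_sumr /=; apply: eq_bigr => i _.
rewrite -big_split mulr_sumr /=; apply: eq_bigr => j ij.
have /negbTE nij : i != j by rewrite neq_ltn ij.
rewrite !twisted_veronese_lift nij /a.
have r2 : Num.sqrt 2 * Num.sqrt 2 = 2 :> K by rewrite -expr2 sqr_sqrtr.
by ring: r2.
Qed.

Lemma twisted_veronese_dist u w :
  \sum_(p in veronese_index n.+1) (twisted_veronese u p - twisted_veronese w p) ^+ 2 =
  2 * q%:R ^+ 2 - 2 * (c u.2 * c w.2 * (dotz (v u.1) (v w.1))%:~R ^+ 2 +
  s u.2 * s w.2 * (dotz (v u.1) (v w.1))%:~R).
Proof.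
have nrm z : \sum_(p in veronese_index n.+1) twisted_veronese z p * twisted_veronese z p = q%:R ^+ 2.
  rewrite twisted_veronese_dot v_norm -!expr2 c_sqr -pmulrn.
  have : (q%:R : K) != 0 by rewrite pnatr_eq0 -lt0n.
  by move: (q%:R) => r r0; field.
rewrite -twisted_veronese_dot mulr_natl mulr2n -{1}(nrm u) -(nrm w) mulr_sumr /=.
rewrite -sumrN -!big_split /=; apply: eq_bigr => p _; ring.
Qed.

(** Integrality enters here: [t ^ 2 + t >= 0] for every integer [t], and the weight of the square
    dominates since [s <= c]. *)
Lemma twisted_dot_ge0 (i j : 'I_m) (t : int) :
  0 <= c i * c j * t%:~R ^+ 2 + s i * s j * t%:~R :> K.
Proof.
have /andP[si _] := s_bounds i; have /andP[sj _] := s_bounds j.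
have ss : s i * s j <= c i * c j by rewrite ler_pM ?s_le_c ?ltW.
have t2 : 0 <= t%:~R ^+ 2 + t%:~R :> K.
  by rewrite -rmorphXn -rmorphD /= ler0z; nia.
have : 0 <= (c i * c j - s i * s j) * t%:~R ^+ 2 :> K.
  by rewrite mulr_ge0 ?subr_ge0 ?sqr_ge0.
have : 0 <= s i * s j * (t%:~R ^+ 2 + t%:~R) :> K.
  by apply: mulr_ge0 => //; apply: mulr_ge0; exact: ltW.
by rewrite mulrDr mulrBl; lra.
Qed.

(** The linear coordinates suffice: the leading one reveals [s], hence the copy, and dividing by [s]
    recovers the vector. *)
Lemma twisted_veronese_inj u w :
  (forall p, p \in veronese_index n.+1 -> twisted_veronese u p = twisted_veronese w p) -> u = w.
Proof.
case: u w => x i [y j] E.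
have L l : s i * vr x l = s j * vr y l.
  by have := E (ord0, l); rewrite inE !twisted_veronese0 => /(_ isT).
have sij : s i = s j by have := L ord0; rewrite /vr !v_head !mulr1.
have /andP[si _] := s_bounds i.
congr (_, _).
  apply: v_inj => l; apply/eqP; rewrite -(eqr_int K); apply/eqP.
  by have := L l; rewrite -sij => /(mulfI (lt0r_neq0 si)).
apply/val_inj/eqP; move/invr_inj/eqP: sij.
by rewrite eqr_nat.
Qed.

End TwistedVeronese.

Local Open Scope ring_scope.

(** Every squared distance is [2 * q ^ 2] minus twice a nonnegative inner product, which vanishes
    for orthogonal vectors. *)
Lemma diameter_graph_blow_up (H : finType) (n q m : nat) (v : H -> 'I_n.+1 -> int)
    (e : rel (H * 'I_m)) d :
  (0 < q)%N -> (forall x, v x ord0 = 1) -> (forall x y, v x =1 v y -> x = y) ->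
  (forall x, dotz (v x) (v x) = q%:Z) ->
  (forall u w, e u w -> dotz (v u.1) (v w.1) = 0) ->
  (n.+1 * (n.+1 + 3) <= 2 * d)%N -> diameter_graph e d.
Proof.
move=> q0 v_head v_inj v_norm eo nd; pose tv := @twisted_veronese R H n q m v.
have tvE u w := @twisted_veronese_dist R H n q m v q0 v_norm u w.
have Ad : (#|veronese_index n.+1| <= d)%N by rewrite -(leq_pmul2l (isT : 0 < 2)%N) card_veronese_index.
have [phi phiP] := embed_coordinates tv Ad.
have distE u w : Defs.edist (phi u) (phi w) ^+ 2 =
    \sum_(p in veronese_index n.+1) (tv u p - tv w p) ^+ 2.
  by rewrite /Defs.edist sqr_sqrtr ?phiP // sumr_ge0 // => i _; rewrite sqr_ge0.
exists phi; split=> [u w uw|u w euw].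
  apply: (@twisted_veronese_inj R _ _ q _ v) => // p pA; apply/eqP; rewrite -subr_eq0 -sqrf_eq0; apply/eqP.
  move: p pA; apply: psumr_eq0P => [p _|]; first by rewrite sqr_ge0.
  by rewrite -distE uw /Defs.edist big1 ?sqrtr0 ?expr0n // => i _; rewrite subrr expr0n.
pose M : R := Num.sqrt (2 * q%:R ^+ 2).
have leM u' w' : Defs.edist (phi u') (phi w') <= M.
  rewrite ler_sqrt ?mulr_ge0 ?exprn_ge0 // phiP tvE.
  by rewrite gerBl mulr_ge0 // twisted_dot_ge0.
have eqM : Defs.edist (phi u) (phi w) = M.
  rewrite /M /Defs.edist phiP tvE (eo _ _ euw).
  by congr Num.sqrt; rewrite mulr0z expr0n !mulr0 addr0 mulr0 subr0.
apply/eqP; rewrite eq_le; apply/andP; split.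
  apply: le_trans (le_bigmax _ _ u).
  exact: (le_bigmax _ (fun y => Defs.edist (phi u) (phi y)) w).
rewrite eqM; apply: bigmax_le => [|x _]; first exact: sqrtr_ge0.
by apply: bigmax_le => [|y _]; [exact: sqrtr_ge0|exact: leM].
Qed.

Lemma large_girth_graph r k d kap g : (0 < r)%N -> (0 < kap)%N ->
  (r * 2 ^ k * (r * 2 ^ k + 3) <= 2 * d)%N ->
  (#|[set e : {ffun 'I_(r * 2 ^ k).-1.+1 -> 'I_3} | mondeg e <= (2 ^ k).-1]| * kap <
    #|{: signed_set (r * 2 ^ k).-1 (2 ^ k)}|)%N ->
  exists (V : finType) (e : rel V), [/\ simple_graph e, diameter_graph e d,
    girth_at_least e g & (kap < chromatic_number e)%N].
Proof.
move=> r0 kap0 rd Ak; have q0 : (0 < 2 ^ k)%N by rewrite expn_gt0.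
have [m [e [se sub ge chi]]] := blow_up_sparsification g
  (@orthogonal_sets_sym (r * 2 ^ k).-1 (2 ^ k)) (@orthogonal_sets_edge _ k) Ak kap0.
exists _, e; split => //.
apply: (@diameter_graph_blow_up _ _ (2 ^ k) _ (@svec _ _)) => //.
- exact: svec0.
- exact: svec_inj.
- by move=> x; exact: svec_norm.
- by move=> u w /sub /eqP.
- by rewrite prednK // muln_gt0 r0.
Qed.

(** * Choice of scale and numerical estimates *)

Lemma dyadic_scale k0 : exists d0, forall d, (d0 <= d)%N -> exists k,
  [/\ (k0 <= k)%N, (2 ^ k * (2 * 2 ^ k + 3) <= d)%N & (d < 2 * 2 ^ k * (4 * 2 ^ k + 3))%N].
Proof.
(* [f k] is the dimension [n * (n + 3) / 2] for [n = 2 * 2 ^ k]; the largest scale that fits into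
   [d] is taken. *)
pose f k := (2 ^ k * (2 * 2 ^ k + 3))%N; exists (f k0) => d d0d.
have fk k : (f k <= d)%N -> (k <= d)%N.
  apply: leq_trans; rewrite (leq_trans (ltnW (ltn_expl k (isT : 1 < 2)%N))) //.
  by rewrite /f leq_pmulr // addn_gt0 orbT.
case: (ex_maxnP (ex_intro (fun k => f k <= d)%N k0 d0d) fk) => k kd kmax.
exists k; split => //; first exact: kmax.
rewrite ltnNge; apply/negP => dk.
suff /kmax : (f k.+1 <= d)%N by rewrite ltnn.
by rewrite /f expnS mulnA.
Qed.

Section Growth.
Local Open Scope ring_scope.

(** Squaring the Bernoulli bound for the exponent [j] gives quadratic growth, which beats the linear
    left side from [j = 10 ^ 6] on. *)
Lemma quadratic_growth (K : realFieldType) (j : nat) : 1000 ^+ 2 <= j%:R :> K ->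
  9 * (3 * (2 * j)%:R + 1) < (1 + 100^-1) ^+ (2 * j) :> K.
Proof.
move=> j0; have bern : 1 + j%:R / 100 <= (1 + 100^-1) ^+ j :> K.
  elim: j {j0} => [|j IH]; first by rewrite mul0r addr0 expr0.
  rewrite exprS -natr1; have : 0 <= j%:R :> K by [].
  by move: IH; move: (_ ^+ j) (j%:R) => X z; lra.
rewrite mulnC exprM natrM; apply: lt_le_trans (_ : (1 + j%:R / 100) ^+ 2 <= _); last first.
  by rewrite ler_pXn2r ?nnegrE ?exprn_ge0 // addr_ge0 // ?divr_ge0.
by move: (j%:R) j0 => z; nra.
Qed.

(** The margin [(1 + 1/100) ^ q] between [mu] and [rho] absorbs the polynomial factor and the
    surplus factor [mu <= 3 / 2] of [mu ^+ q.+1], whence [9 = 6 * 3 / 2] in [growth]. *)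
Lemma counting_ineq (A M kap q : nat) (alpha beta mu rho : R) :
  (exists2 j, q = (2 * j)%N & 1000 ^+ 2 <= j%:R :> R) ->
  0 < alpha -> beta = alpha * rho -> 1 <= mu <= 3 / 2 -> mu * (1 + 100^-1) <= rho ->
  A%:R <= alpha ^+ q -> beta ^+ q <= 6 * (3 * q%:R + 1) * M%:R ->
  kap%:R <= mu ^+ q.+1 -> (A * kap < M)%N.
Proof.
move=> [j qj j0] al1 -> /andP[mu1 mu2] murho Aal aM kmu.
have growth : 9 * (3 * q%:R + 1) < (1 + 100^-1) ^+ q :> R by rewrite qj; exact: quadratic_growth.
have c0 : 0 < 6 * (3 * q%:R + 1) :> R by have : 0 <= q%:R :> R by []; lra.
have kr : kap%:R * (6 * (3 * q%:R + 1)) < rho ^+ q.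
  apply: lt_le_trans (_ : (mu * (1 + 100^-1)) ^+ q <= _); last first.
    by apply: lerXn2r; rewrite ?nnegrE; lra.
  apply: le_lt_trans (_ : mu ^+ q.+1 * (6 * (3 * q%:R + 1)) < _).
    by rewrite ler_wpM2r // ltW.
  rewrite exprSr exprMn -mulrA ltr_pM2l ?exprn_gt0 //; last by lra.
  apply: le_lt_trans growth; have : 0 <= q%:R :> R by []; nra.
rewrite -(ltr_nat R) -(ltr_pM2l c0) natrM.
apply: lt_le_trans aM; rewrite exprMn.
apply: le_lt_trans (_ : alpha ^+ q * (kap%:R * (6 * (3 * q%:R + 1))) < _).
  rewrite mulrC -mulrA ler_wpM2r // mulr_ge0 // ltW //.
by rewrite ltr_pM2l // exprn_gt0.
Qed.

End Growth.

Section Scale.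
Local Open Scope ring_scope.

(** The threshold 21 comes from [2 ^ 20 >= 1000 ^ 2]. *)
Lemma pow2_large (K : realFieldType) k : (21 <= k)%N ->
  exists2 j, (2 ^ k = 2 * j)%N & 1000 ^+ 2 <= j%:R :> K.
Proof.
move=> k21; exists (2 ^ k.-1)%N.
  by rewrite -expnS prednK //; exact: leq_trans k21.
have k20 : (20 <= k.-1)%N by rewrite -ltnS prednK //; exact: leq_trans k21.
apply: le_trans (_ : (2 ^+ 10) ^+ 2 <= _).
  have H : 1000 <= 2 ^+ 10 :> K by lra.
  apply: lerXn2r H; last by rewrite nnegrE exprn_ge0.
  by rewrite nnegrE; exact: ler0n.
by rewrite natrX -exprM ler_weXn2l ?ler1n.
Qed.

(* [alpha] bounds the size of an independent set and [alpha * rho] the size of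
   the family of vectors, both as growth rates per unit of [2 ^ k]. *)
Lemma graph_at_scale r k d g (b mu rho sigma : R) :
  let alpha := 3 * (13 / 9) ^+ r in
  (1 < r <= 3)%N -> (21 <= k)%N -> (r * 2 ^ k * (r * 2 ^ k + 3) <= 2 * d)%N ->
  2 * r%:R ^+ r = alpha * rho * r.-1%:R ^+ r.-1 ->
  1 <= b -> 0 <= sigma -> d%:R <= (sigma * (2 ^ k).+1%:R) ^+ 2 ->
  powR b sigma <= mu -> 1 <= mu <= 3 / 2 -> mu * (1 + 100^-1) <= rho ->
  exists (V : finType) (e : rel V), [/\ simple_graph e, diameter_graph e d,
    girth_at_least e g & powR b (Num.sqrt d%:R) <= (chromatic_number e)%:R].
Proof.
move=> alpha /andP[r1 r3] k21 rd rhoE b1 sig0 dsig bmu mu12 murho.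
have r0 : (0 < r)%N := ltnW r1; set q := (2 ^ k)%N in rd dsig *.
have q0 : (0 < q)%N by rewrite expn_gt0.
(* A chromatic number above the integer part [kap] of [X] is at least [kap + 1], hence exceeds
   [X]. *)
set X := powR b _; pose kap := Num.truncn X.
have X1 : 1 <= X.
  by rewrite -(powRr0 b) ler_powR ?sqrtr_ge0.
have /andP[kX Xk] := truncn_itv (le_trans ler01 X1).
have Xmu : X <= mu ^+ q.+1.
  apply: le_trans (_ : powR b (sigma * q.+1%:R) <= _).
    rewrite ler_powR // -[leRHS]ger0_norm ?mulr_ge0 // -sqrtr_sqr ler_wsqrtr //.
  rewrite powRrM powR_mulrn ?powR_ge0 //.
  by apply: lerXn2r; rewrite ?nnegrE ?powR_ge0 //; have /andP[] := mu12; lra.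
have kap0 : (0 < kap)%N.
  by rewrite /kap truncn_gt0.
have Ek : (#|[set e : {ffun 'I_(r * q).-1.+1 -> 'I_3} | (mondeg e <= q.-1)%N]| * kap <
    #|{: signed_set (r * q).-1 q}|)%N.
  apply: (@counting_ineq _ _ _ q alpha _ mu rho (pow2_large R k21) _ erefl mu12 murho).
  - by rewrite mulr_gt0 ?exprn_gt0 ?divr_gt0.
  (* For [n = r * q] the bound is [3 ^ (q - 1) * (13 / 9) ^ (r * q)], at most [alpha ^ q]. *)
  - have := card_expo (r * q).-1.+1 q0; rewrite prednK ?muln_gt0 ?r0 //.
    set A := #|_|; rewrite -(ler_nat R) !natrM !natrX => H.
    rewrite exprMn -exprM expr_div_n mulrA ler_pdivlMr ?exprn_gt0 //.
    apply: le_trans H _; rewrite ler_wpM2r ?exprn_ge0 // ler_weXn2l ?ler1n //.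
    exact: leq_pred.
  - have := card_signed_set_geq r0 q0; set M := #|_| => H.
    rewrite -(ler_nat R) !natrM !natrX in H.
    have p0 : 0 < r.-1%:R :> R by rewrite ltr0n -subn1 subn_gt0.
    have E : alpha * rho = 2 * r%:R ^+ r / r.-1%:R ^+ r.-1.
      by rewrite rhoE mulfK // gt_eqF // exprn_gt0.
    rewrite E expr_div_n ler_pdivrMr; last by rewrite !exprn_gt0.
    rewrite exprMn -exprM mulrC.
    apply: le_trans H _.
    have -> : (r * q - q = r.-1 * q)%N by rewrite -subn1 mulnBl mul1n.
    rewrite exprM mulrAC ler_wpM2r ?exprn_ge0 // ler_wpM2r //.
    have : (2 * r * (r * q).+1 <= 6 * (3 * q + 1))%N by nia.
    by rewrite -(ler_nat R) !natrM natrD natrM.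
  - exact: le_trans kX Xmu.
have [V [e [se de ge chi]]] := large_girth_graph g r0 kap0 rd Ek.
exists V, e; split => //; apply: le_trans (ltW Xk) _.
by rewrite ler_nat.
Qed.

End Scale.

Local Open Scope classical_set_scope.
Local Open Scope ring_scope.

Theorem theorem1p2 :
  exists eps : nat -> R, eps @ \oo --> (0 : R) /\
  forall g d : nat, leq 3 g -> leq 1 d ->
    exists (V : finType) (e : rel V),
      simple_graph e /\ diameter_graph e d /\ girth_at_least e g /\
      powR (1107%:R / 1000%:R + eps d) (Num.sqrt (d%:R : R))
        <= (chromatic_number e)%:R.
Proof.
have [d0 scale] := dyadic_scale 21.
(* Below [d0] the correction lowers the base to exactly 1, so a single vertex suffices there. *)
exists (fun d => if (d0 <= d)%N then 0 else - (107 / 1000)); split.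
  apply: cvg_near_cst; near=> d.
  by rewrite ifT //; near: d; exact: nbhs_infty_ge.
move=> g d _ _; case: ifPn => [/scale[k [k21 kd dk]]|_]; last first.
  exists unit, [rel _ _ | false]; split; first by [].
  split; first by exists (fun=> 0); split => // -[] [].
  split; first by case=> [|x [|y s]] //=; rewrite ?andbF.
  have -> : 1107%:R / 1000%:R - 107 / 1000 = 1 :> R by lra.
  rewrite powR1 ler1n; apply: chromatic_number_gt => [|W]; first by rewrite card_unit.
  by rewrite card_unit mul0n.
rewrite addr0; set b := (X in powR X _); set q := (2 ^ k)%N in kd dk.
have b1 : 1 <= b by rewrite /b; lra.
(* The dimension lies roughly between [2 * q ^ 2] and [8 * q ^ 2]. From about [4.5 * q ^ 2] on,
   [n = 3 * q] fits, with [sqrt 8 < 3 = sigma]. *)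
have [rd|rd] := leqP (3 * q * (3 * q + 3)) (2 * d).
  have [||||||||||V [e [se de ge chi]]] :=
    @graph_at_scale 3 k d g b (136 / 100)%R (6561 / 4394)%R 3%R; last by exists V, e.
  - by [].
  - exact: k21.
  - exact: rd.
  - by rewrite -[(3.-1)%N]/2%N; lra.
  - exact: b1.
  - by rewrite ler0n.
  - have : (d <= (3 * q.+1) ^ 2)%N by nia.
    by rewrite -(ler_nat R) natrX natrM.
  - by rewrite (powR_mulrn 3) /b; lra.
  - lra.
  - lra.
(* Here [d] is below about [4.5 * q ^ 2], and [sqrt 4.5 < 9 / 4 = sigma] for [n = 2 * q]. *)
have [||||||||||V [e [se de ge chi]]] :=
  @graph_at_scale 2 k d g b (126 / 100)%R (216 / 169)%R (9 / 4)%R; last by exists V, e.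
- by [].
- exact: k21.
- by rewrite -/q; lia.
- by rewrite -[(2.-1)%N]/1%N; lra.
- exact: b1.
- lra.
- have : (16 * d <= (9 * q.+1) ^ 2)%N by nia.
  rewrite -(ler_nat R) natrX !natrM.
  move: (d%:R) (q.+1%:R) => x y; nra.
- have b0 : 0 <= b by lra.
  (* Fourth powers clear the exponent [9 / 4], leaving [1.107 ^ 9 <= 1.26 ^ 4]. *)
  rewrite -(@ler_pXn2r _ 4) ?nnegrE ?powR_ge0 //.
  rewrite -powR_mulrn ?powR_ge0 // -powRrM.
  have -> : 9 / 4 * 4%:R = 9%:R :> R by lra.
  rewrite powR_mulrn // /b; lra.
- lra.
- lra.
Unshelve. all: by end_near. Qed.
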